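(* The chance constrained program $v^*=\min_{x\in\mathcal X}\{c^\top x:\ \mathbb P\{g(x,\tilde\xi)\le0\}\ge1-\varepsilon\}$ is equivalent to the bilinear program $$v^*=\min_{x\in\mathcal X,\ z(\cdot),\ s(\cdot)}\big\{c^\top x:\ g(x,\tilde\xi)\le s(\tilde\xi),\ \mathbb E[z(\tilde\xi)]\ge1-\varepsilon,\ z(\tilde\xi)\in[0,1],\ \mathbb E[z(\tilde\xi)s(\tilde\xi)]=0,\ s(\tilde\xi)\ge0\big\}.$$
   Context: Setting. $\tilde\xi$ is a random vector on a probability space $(\Omega,\mathcal F,\mathbb P)$ with support $\Xi\subseteq\mathbb R^m$; $\varepsilon\in(0,1)$; $c\in\mathbb R^n$. $z(\cdot),s(\cdot):\Xi\to\mathbb R$ are measurable functions; all constraints on random quantities hold almost surely. Standing assumptions. (A1) $g(x,\xi)=\max_{i\in[I]}g_i(x,\xi)$ with $g_i:\mathbb R^n\times\Xi\to\mathbb R$, each $g_i(x,\xi)$ convex and lower semicontinuous in $x$ for almost every $\xi\in\Xi$. (A2) $\mathcal X\subseteq\mathbb R^n$ is nonempty, closed, convex and contained in a closed pointed convex cone $\mathcal C$. (A3) The feasible region of the chance constrained program is nonempty and $c\in\mathrm{int}(\mathcal C^* )\cup\{0\}$ ($\mathcal C^*$ the dual cone). ''Equivalent'' means the two problems have the same optimal value. *)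

(* Defs.v *)
From HB Require Import structures.
From mathcomp Require Import all_boot all_order all_algebra.
From mathcomp Require Import all_classical all_reals all_analysis.
Import Order.TTheory GRing.Theory Num.Theory.
Import numFieldNormedType.Exports.

Set Implicit Arguments.
Unset Strict Implicit.
Unset Printing Implicit Defensive.

Local Open Scope classical_set_scope.
Local Open Scope ring_scope.

(* R^m with its Borel sigma-algebra; the carrier is convertible to 'rV[R]_m. *)
Notation borel_rV R m := (g_sigma_algebraType (@open 'rV[R]_m)).

Definition dotp (R : realType) (n : nat) (c x : 'rV[R]_n) : R :=
  \sum_(j < n) c ord0 j * x ord0 j.

Definition closed_pointed_convex_cone (R : realType) (n : nat)
    (C : set 'rV[R]_n) : Prop :=
  [/\ closed C, convex_set C,
      (forall (l : R) x, 0 <= l -> C x -> C (l *: x)) &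
      (forall x, C x -> C (- x) -> x = 0)].

Definition dual_cone (R : realType) (n : nat) (C : set 'rV[R]_n) :
    set 'rV[R]_n :=
  [set y | forall x, C x -> 0 <= dotp y x].

Definition is_min (R : realType) (T : Type) (F : set T) (f : T -> R) (v : R) :
    Prop :=
  (exists2 t, F t & f t = v) /\ (forall t, F t -> v <= f t).

(* Seeding the iterated maximum with one of the terms makes it the plain
   maximum of the k.+1 values. *)
Definition gmax (R : realType) (n m k : nat)
    (g : 'I_k.+1 -> 'rV[R]_n -> 'rV[R]_m -> R) (x : 'rV[R]_n) (y : 'rV[R]_m) :
    R :=
  \big[Num.max/g ord0 x y]_(i < k.+1) g i x y.

Section random_data.
Context (R : realType) (d : measure_display) (Omega : measurableType d).
Context (P : probability Omega R) (m : nat) (xi : {RV P >-> borel_rV R m}).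

Definition is_support (Xi : set 'rV[R]_m) : Prop :=
  [/\ closed Xi, P (xi @^-1` Xi) = 1%E &
      forall F : set 'rV[R]_m, closed F -> P (xi @^-1` F) = 1%E -> Xi `<=` F].

(* E[h(xi)] for a function h which is only meaningful on Xi: h is replaced by 0
   off Xi, a set that xi almost surely avoids when Xi is its support. *)
Definition expect_on (Xi : set 'rV[R]_m) (h : 'rV[R]_m -> R) : \bar R :=
  'E_P[patch (fun=> 0) Xi h \o xi].

Context (n k : nat) (Xi : set 'rV[R]_m).
Context (g : 'I_k.+1 -> 'rV[R]_n -> 'rV[R]_m -> R).
Context (X : set 'rV[R]_n) (eps : R).

(* The values of g, z and s off Xi are irrelevant, hence the intersection with
   Xi in the event. *)
Definition ccp_feasible : set 'rV[R]_n :=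
  [set x | X x /\
    ((1 - eps)%:E <= P (xi @^-1` (Xi `&` [set y | (gmax g x y <= 0)%R])))%E].

Definition bilinear_feasible :
    set ('rV[R]_n * ('rV[R]_m -> R) * ('rV[R]_m -> R)) :=
  [set t | let: (x, z, s) := t in
    [/\ X x,
        measurable_fun (Xi : set (borel_rV R m)) z &
        measurable_fun (Xi : set (borel_rV R m)) s] /\
    [/\ {ae P, forall w, gmax g x (xi w) <= s (xi w)},
        ((1 - eps)%:E <= expect_on Xi z)%E,
        {ae P, forall w, 0 <= z (xi w) <= 1},
        expect_on Xi (fun y => (z y * s y)%R) = 0%E &
        {ae P, forall w, 0 <= s (xi w)}]].

End random_data.

(* Main.v *)
(* The two programs have the same feasible x. From x feasible for the chance
   constraint, take z = the indicator of {g(x,.) <= 0} and s = max(g(x,.), 0).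
   Conversely, z s >= 0 and E[z s] = 0 force z s = 0 almost surely, so that
   g(x,.) <= s = 0 wherever z > 0; hence z <= 1_{g(x,.) <= 0} and
   1 - eps <= E[z] <= P(g(x,.) <= 0).
   The minimum is attained: lower semicontinuity puts the limsup of the events
   {g(x_j,.) <= 0} inside {g(x,.) <= 0} when x_j --> x, so the feasible set is
   closed, and for c interior to the dual cone its sublevel sets are bounded. *)

Require Import Defs.
From HB Require Import structures.
From mathcomp Require Import all_boot all_order all_algebra.
From mathcomp Require Import all_classical all_reals all_analysis.
From mathcomp Require Import measurable_realfun.
Import Order.TTheory GRing.Theory Num.Theory.
Import numFieldNormedType.Exports.

Set Implicit Arguments.
Unset Strict Implicit.
Unset Printing Implicit Defensive.

Local Open Scope classical_set_scope.
Local Open Scope ring_scope.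

(** * Finite maxima and Borel measurability *)

Lemma gmax_leP (R : realType) (n m k : nat)
    (g : 'I_k.+1 -> 'rV[R]_n -> 'rV[R]_m -> R) x y (a : R) :
  gmax g x y <= a <-> forall i, g i x y <= a.
Proof.
split=> [/bigmax_leP[_ h] i|h]; first exact: h.
by apply/bigmax_leP; split.
Qed.

Lemma measurable_gmax (R : realType) (n m k : nat) (D : set 'rV[R]_m)
    (g : 'I_k.+1 -> 'rV[R]_n -> 'rV[R]_m -> R) x :
  (forall i, measurable_fun (D : set (borel_rV R m)) (g i x)) ->
  measurable_fun (D : set (borel_rV R m)) (gmax g x).
Proof.
move=> mg; rewrite /gmax.
elim: (index_enum _) => [|i s ih].
  by under eq_fun do rewrite big_nil; exact: mg.
under eq_fun do rewrite big_cons.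
exact: measurable_maxr.
Qed.

Lemma closed_measurable_borel (R : realType) (m : nat) (F : set 'rV[R]_m) :
  closed F -> measurable (F : set (borel_rV R m)).
Proof.
move=> cF; rewrite -[F]setCK; apply: measurableC.
by apply: sub_sigma_algebra; exact: closed_openC.
Qed.

(** * Almost sure comparison of events and limits superior *)

Section probability_ae.
Context (R : realType) (d : measure_display) (T : measurableType d).
Context (P : probability T R).

Lemma probability1_ae (A : set T) :
  measurable A -> P A = 1%E -> {ae P, forall w, A w}.
Proof.
move=> mA PA; exists (~` A); split => //; first exact: measurableC.
by rewrite probability_setC// PA subee.
Qed.

Lemma ae_le_probability (A B : set T) : measurable A -> measurable B ->
  {ae P, forall w, A w -> B w} -> (P A <= P B)%E.
Proof.
move=> mA mB [N [mN PN sN]].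
(* Adjoining the null set [N] to [B] does not change its probability, and [A] is contained in the
   enlarged set. *)
rewrite -(measureU0 mB mN PN); apply: le_measure; rewrite ?inE//.
  exact: measurableU.
move=> w Aw; have [Bw|nBw] := pselect (B w); [by left|right].
by apply: sN => /(_ Aw).
Qed.

(* Continuity from above, along the decreasing tails whose intersection is the
   limit superior of the events. *)
Lemma le_probability_limsup (A : (set T)^nat) (a : \bar R) :
  (forall j, measurable (A j)) -> (forall j, (a <= P (A j))%E) ->
  (a <= P (\bigcap_j \bigcup_(i >= j) A i))%E.
Proof.
move=> mA leA.
pose F j := \bigcup_(i >= j) A i.
have mF j : measurable (F j) by apply: bigcup_measurable => i _.
have cvF : (P \o F) x @[x --> \oo] --> P (\bigcap_j F j).
  apply: nonincreasing_cvg_mu => //.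
  - by rewrite (le_lt_trans (probability_le1 _ _))// ltry.
  - exact: bigcapT_measurable.
  - move=> i j ij; apply/subsetPset => w [l /= jl Al].
    by exists l => //=; exact: leq_trans jl.
apply: (cvge_ge _ cvF); apply: nearW => j /=.
apply: (le_trans (leA j)); apply: le_measure; rewrite ?inE//.
by move=> w Aw; exists j => /=.
Qed.

End probability_ae.

(** * Linear objectives bounded below on a cone *)

Section cone.
Context (R : realType) (n : nat).
Implicit Types c x : 'rV[R]_n.

Lemma dotp_continuous c : continuous (dotp c).
Proof.
apply: (@continuous_big _ _ +%R 0 xpredT add_continuous) => j _ x.
by apply: continuousM; [exact: cst_continuous|exact: coord_continuous].
Qed.

(* A nonzero entry x_j is detected by moving c in the direction - sgn(x_j) e_j,
   which stays in the dual cone. *)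
Lemma interior_dual_cone_coercive (C : set 'rV[R]_n) c :
  interior (dual_cone C) c ->
  exists2 e : R, 0 < e & forall x, C x -> forall j, e * `|x ord0 j| <= dotp c x.
Proof.
move=> /nbhs_ballP[e /= e0 ballC].
have [r r0 re] : exists2 r : R, 0 < r & r < e.
  by exists (e / 2); rewrite ?divr_gt0// ltr_pdivrMr// ltr_pMr// ltr1n.
exists r => // x Cx j.
pose c' := c - (r * Num.sg (x ord0 j)) *: delta_mx ord0 j.
have : dual_cone C c'.
  apply: ballC; rewrite mx_norm_ball /ball_ /= /c' opprB addrC subrK normrZ.
  have lsg : `|Num.sg (x ord0 j)| <= 1 by rewrite normr_sg lern1 leq_b1.
  apply: le_lt_trans re.
  rewrite normrM gtr0_norm// -mulrA ler_piMr ?(ltW r0)//.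
  apply: mulr_ile1 => //.
  (* The norm is the largest absolute entry, so [delta_mx] has norm at most 1. *)
  rewrite [leLHS]/Num.Def.normr/= mx_normrE; apply: bigmax_le => // -[i l] _ /=.
  by rewrite mxE normr_nat lern1 leq_b1.
move=> /(_ x Cx).
rewrite /dotp /c'.
under eq_bigr do rewrite !mxE mulrBl.
rewrite sumrB subr_ge0; apply: le_trans.
rewrite (bigD1 j)//= big1 ?addr0 => [|i ij]; last first.
  by rewrite (negbTE ij) mulr0 mul0r.
by rewrite eqxx mulr1 -mulrA -normrEsg.
Qed.

End cone.

(** * Feasibility in the two programs and closedness *)

Section chance_constraint.
Context (R : realType) (d : measure_display) (Omega : measurableType d).
Context (P : probability Omega R) (n m k : nat) (xi : {RV P >-> borel_rV R m}).
Context (Xi : set 'rV[R]_m) (hXi : is_support xi Xi).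
Context (eps : R) (g : 'I_k.+1 -> 'rV[R]_n -> 'rV[R]_m -> R).
Context (g_meas :
  forall i x, measurable_fun (Xi : set (borel_rV R m)) (g i x)).

Let mXi : measurable (Xi : set (borel_rV R m)).
Proof. by case: hXi => cXi _ _; exact: closed_measurable_borel. Qed.

Let mpre (B : set 'rV[R]_m) :
  measurable (B : set (borel_rV R m)) -> measurable (xi @^-1` B).
Proof.
by move=> mB; rewrite -[_ @^-1` _]setTI; exact: (measurable_funPT xi).
Qed.

Lemma ae_support : {ae P, forall w, Xi (xi w)}.
Proof. by case: hXi => _ PXi _; apply: probability1_ae => //; exact: mpre. Qed.

Lemma measurable_safe_set x :
  measurable (Xi `&` [set y | gmax g x y <= 0] : set (borel_rV R m)).
Proof.
apply: (@measurable_fun_le _ (borel_rV R m) R Xi (gmax g x) (cst 0)) => //.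
exact: measurable_gmax.
Qed.

(** Since [Xi] is Borel, extending by 0 turns measurability on [Xi] into measurability
    everywhere. *)
Let patch_comp_measurable (h : 'rV[R]_m -> R) :
  measurable_fun (Xi : set (borel_rV R m)) h ->
  measurable_fun setT (patch (fun=> 0) Xi h \o xi).
Proof.
move=> mh.
have /(@measurable_restrictT _ _ (borel_rV R m)) mph := mh.
exact: (measurableT_comp (mph mXi)).
Qed.

Lemma ccp_bilinear_feasible X x : ccp_feasible xi Xi g X eps x ->
  exists z s, bilinear_feasible xi Xi g X eps (x, z, s).
Proof.
move=> [Xx Px].
set A := Xi `&` _ in Px.
have mA : measurable (A : set (borel_rV R m)) by exact: measurable_safe_set.
exists (\1_A), (fun y => Num.max (gmax g x y) 0); split; split => //=.
- by apply: (@measurable_maxr _ (borel_rV R m)) => //; exact: measurable_gmax.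
- by apply: aeW => w /=; rewrite le_max lexx.
- rewrite /expect_on.
  (* As [A] lies inside [Xi], patching its indicator changes nothing, and the expectation is the
     probability of [A]. *)
  have -> : patch (fun=> 0) Xi \1_A \o xi = (\1_(xi @^-1` A) : Omega -> R).
    apply/funext => w /=; rewrite patchE !indicE.
    have -> : (w \in xi @^-1` A) = (xi w \in A) by apply/idP/idP; rewrite !inE.
    case: ifPn => // /negP nXi; case: (boolP (xi w \in A)) => //.
    by rewrite inE => -[Xiw _]; exfalso; apply: nXi; rewrite inE.
  by rewrite expectation_indic//; exact: mpre.
- by apply: aeW => w /=; rewrite indicE; case: (_ \in _); rewrite lexx ler01.
- rewrite /expect_on.
  rewrite [X in expectation _ X](_ : _ = cst 0) ?expectation_cst//.
  apply/funext => w /=; rewrite patchE; case: ifPn => // _.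
  rewrite indicE; case: (boolP (xi w \in A)); rewrite ?mul0r//.
  by rewrite inE => -[_ /= g0]; rewrite mul1r; apply/max_idPr.
- by apply: aeW => w /=; rewrite le_max lexx orbT.
Qed.

Lemma bilinear_ccp_feasible X x z s :
  bilinear_feasible xi Xi g X eps (x, z, s) -> ccp_feasible xi Xi g X eps x.
Proof.
move=> [[Xx mz ms] [gs Ez z01 Ezs s0]]; split => //.
apply: (le_trans Ez); rewrite /expect_on.
set Z := patch _ _ z \o xi; set A := Xi `&` _.
have mA : measurable (xi @^-1` A) by apply: mpre; exact: measurable_safe_set.
have mZ : measurable_fun setT Z by exact: patch_comp_measurable.
move: Ezs; rewrite /expect_on; set H := patch _ _ _ \o xi => EH.
have mH : measurable_fun setT H.
  by apply: patch_comp_measurable; exact: measurable_funM.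
have HE w : Xi (xi w) -> H w = z (xi w) * s (xi w).
  by move=> Xiw; rewrite /H /= patchE mem_set.
have ZE w : Xi (xi w) -> Z w = z (xi w).
  by move=> Xiw; rewrite /Z /= patchE mem_set.
(* Almost surely [H] equals its absolute value, whose integral is therefore 0; this forces [H] to
   vanish almost surely. *)
have H0 : ae_eq P setT (EFin \o H) (cst 0%E).
  apply/(ae_eq_integral_abs P measurableT); first exact/measurable_EFinP.
  rewrite -EH unlock; apply: ae_eq_integral => //.
  - by apply: measurableT_comp => //; exact/measurable_EFinP.
  - exact/measurable_EFinP.
  - near=> w => _ /=.
    have Xiw : Xi (xi w) by near: w; exact: ae_support.
    have /andP[z0 _] : 0 <= z (xi w) <= 1 by near: w.
    have sw : 0 <= s (xi w) by near: w.
    by rewrite ger0_norm// HE// mulr_ge0.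
have -> : P (xi @^-1` A) = (\int[P]_w (\1_(xi @^-1` A) w)%:E)%E.
  by rewrite integral_indic// setIT.
rewrite unlock.
(* [Z] is nonnegative only almost surely, whereas the comparison of integrals below asks for this
   everywhere; hence the absolute value. *)
have -> : (\int[P]_w (Z w)%:E = \int[P]_w `|(Z w)%:E|)%E.
  apply: ae_eq_integral => //.
  - exact/measurable_EFinP.
  - by apply: measurableT_comp => //; exact/measurable_EFinP.
  - near=> w => _ /=.
    have Xiw : Xi (xi w) by near: w; exact: ae_support.
    have /andP[z0 _] : 0 <= z (xi w) <= 1 by near: w.
    by rewrite ZE// ger0_norm.
apply: ae_ge0_le_integral => //.
- by apply: measurableT_comp => //; exact/measurable_EFinP.
- by apply/measurable_EFinP; exact: measurable_indic.
near=> w => _.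
have Xiw : Xi (xi w) by near: w; exact: ae_support.
have /andP[z0 z1] : 0 <= z (xi w) <= 1 by near: w.
have sw : 0 <= s (xi w) by near: w.
have gw : gmax g x (xi w) <= s (xi w) by near: w.
have : setT w -> (H w)%:E = 0%E by near: w; exact: H0.
(* Either [z] is 0, below any indicator, or [s] is 0, which puts the point in [A], where the
   indicator is 1 and bounds [z]. *)
move=> /(_ I) [] /eqP; rewrite HE// mulf_eq0 => /orP[/eqP zw|/eqP sw0].
  by rewrite abse_EFin ZE// zw normr0 lee_fin indicE ler0n.
rewrite abse_EFin ZE// lee_fin ger0_norm// indicE mem_set//.
by split => //=; rewrite -sw0.
Unshelve. all: by end_near. Qed.

Lemma closed_ccp_feasible X : closed X ->
  (forall i,
    {ae P, forall w, lower_semicontinuous (fun x => (g i x (xi w))%:E)}) ->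
  closed (ccp_feasible xi Xi g X eps).
Proof.
move=> cX glsc x clx.
have clxX : X x by apply: cX; apply: closure_subset clx => y [].
split => //.
have /choice[u uP] : forall j, exists y,
    ccp_feasible xi Xi g X eps y /\ ball x j.+1%:R^-1 y.
  move=> j; have j0 : 0 < j.+1%:R^-1 :> R by rewrite invr_gt0 ltr0n.
  by have [y [Sy xy]] := clx _ (nbhsx_ballx x _ j0); exists y.
have cvgu : u @ \oo --> x.
  apply/cvg_ballP => e e0.
  near=> j; apply: (@le_ball _ _ _ j.+1%:R^-1); last by case: (uP j).
  near: j; have := near_infty_natSinv_lt (PosNum e0).
  by apply: filterS => j /= /ltW.
pose A j := xi @^-1` (Xi `&` [set y | gmax g (u j) y <= 0]).
have mA j : measurable (A j) by apply: mpre; exact: measurable_safe_set.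
have leA j : ((1 - eps)%:E <= P (A j))%E by case: (uP j) => -[].
apply: (le_trans (le_probability_limsup mA leA)).
apply: ae_le_probability.
- by apply: bigcapT_measurable => j; apply: bigcup_measurable => i _.
- by apply: mpre; exact: measurable_safe_set.
have : {ae P, forall w, forall i,
    lower_semicontinuous (fun x => (g i x (xi w))%:E)}.
  (* The index set is finite, so one null set serves all [i]. *)
  exact: filter_forall.
apply: filterS => w lscw Aw.
have Xiw : Xi (xi w) by have [j _ []] := Aw 0%N I.
split => //=; apply/gmax_leP => i; rewrite leNgt; apply/negP => gpos.
(* Positivity of [g i] at [x] persists on a neighbourhood [V] containing all late [u j], yet [w]
   lies in [A j] for arbitrarily late [j]. *)
have [V Vx Vpos] := lscw i x 0 gpos.
have [N _ NV] := cvgu _ Vx.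
have [j /= Nj [_ /= /gmax_leP /(_ i)]] := Aw N I.
by apply/negP; rewrite -ltNge -lte_fin; apply: Vpos; exact: NV.
Unshelve. all: by end_near. Qed.

End chance_constraint.

(** * Attainment of the minimum and equality of the values *)

Lemma exists_min_dotp (R : realType) (n : nat) (S C : set 'rV[R]_n) c :
  closed S -> S !=set0 -> S `<=` C -> interior (dual_cone C) c \/ c = 0 ->
  exists v, is_min S (fun x => dotp c x) v.
Proof.
move=> cS [x0 Sx0] SC [cC|->]; last first.
  have dotp0 x : dotp 0 x = 0 :> R.
    by rewrite /dotp big1// => j _; rewrite mxE mul0r.
  by exists 0; split; [exists x0|move=> x _; rewrite dotp0].
have [e e0 coer] := interior_dual_cone_coercive cC.
(* Minimizing over the sublevel set of one feasible point [x0] suffices, and this set is compact. *)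
pose K := S `&` [set x | dotp c x <= dotp c x0].
have bK : bounded_set K.
  exists (dotp c x0 / e); split; first exact: num_real.
  move=> M ltM x [Sx xle].
  (* The maximum defining the norm starts from 0, so its bound must be nonnegative. *)
  have M0 : 0 <= M.
    apply: ltW; apply: le_lt_trans ltM; rewrite divr_ge0 ?(ltW e0)//.
    by have dc : dual_cone C c := interior_subset cC; exact: dc (SC _ Sx0).
  rewrite /= [leLHS]/Num.Def.normr/= mx_normrE.
  apply: bigmax_le => // -[i j] _ /=.
  rewrite ord1; apply: le_trans (ltW ltM).
  by rewrite ler_pdivlMr// mulrC (le_trans (coer _ (SC _ Sx) j)).
have cK : closed K.
  apply: closedI => //.
  by apply: preimage_closed (@closed_le R (dotp c x0)) => x _;
    exact: dotp_continuous.
have [||x] := @EVT_min_rV R n (dotp c) K _ (bounded_closed_compact bK cK).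
- by exists x0; split => /=.
- by apply: continuous_subspaceT; exact: dotp_continuous.
rewrite inE => -[Sx xle] xmin; exists (dotp c x); split; first by exists x.
move=> y Sy; have [yle|/ltW] := leP (dotp c y) (dotp c x0).
  by apply: xmin; rewrite inE.
exact: le_trans.
Qed.

Theorem proposition1 (R : realType) (d : measure_display)
    (Omega : measurableType d) (P : probability Omega R)
    (n m k : nat)
    (xi : {RV P >-> borel_rV R m}) (Xi : set 'rV[R]_m)
    (hXi : is_support xi Xi)
    (eps : R) (heps0 : 0 < eps) (heps1 : eps < 1)
    (c : 'rV[R]_n)
    (g : 'I_k.+1 -> 'rV[R]_n -> 'rV[R]_m -> R)
    (g_meas : forall i x, measurable_fun (Xi : set (borel_rV R m)) (g i x))
    (g_convex : forall i,
      {ae P, forall w, convex_function setT (fun x => g i x (xi w))})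
    (g_lsc : forall i,
      {ae P, forall w, lower_semicontinuous (fun x => (g i x (xi w))%:E)})
    (X : set 'rV[R]_n)
    (X_nonempty : X !=set0) (X_closed : closed X) (X_convex : convex_set X)
    (C : set 'rV[R]_n) (hC : closed_pointed_convex_cone C) (hXC : X `<=` C)
    (feasible : ccp_feasible xi Xi g X eps !=set0)
    (hc : interior (dual_cone C) c \/ c = 0) :
  exists v : R,
    is_min (ccp_feasible xi Xi g X eps) (fun x => dotp c x) v /\
    is_min (bilinear_feasible xi Xi g X eps) (fun t => dotp c t.1.1) v.
Proof.
have [v minv] := exists_min_dotp (closed_ccp_feasible hXi g_meas X_closed g_lsc)
  feasible (fun x Sx => hXC x (proj1 Sx)) hc.
(* The objective sees only the [x] component, so a minimizer lifts to a triple, and any feasible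
   triple projects to a competitor. *)
exists v; split => //; case: minv => -[x Sx xv] minv; split.
  have [z [s zs]] := ccp_bilinear_feasible hXi g_meas Sx.
  by exists (x, z, s).
by move=> [[y z] s] /(bilinear_ccp_feasible hXi g_meas); exact: minv.
Qed.
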